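(* There is an absolute constant $\beta<\infty$ such that for all integers $n,k\ge 1$ there exists an $n$-agent, $k$-unit platform mechanism $M$ whose expected residual surplus satisfies $$M(\mathbf v)\ \ge\ \tfrac1\beta\,\mathcal G(\mathbf v)\qquad\text{for every valuation profile }\mathbf v\in[0,\infty)^n ,$$ i.e. $M$ is universally adopted with constant competitive advantage $\beta$ (independent of $n$, $k$ and the valuations).
   Context: There are $k$ identical units and $n$ unit-demand agents with values $\mathbf v\in[0,\infty)^n$. A platform mechanism is a single (prior-free, possibly randomized) mechanism given by allocation probabilities $x_i(\mathbf v)\in[0,1]$, coming from a random assignment of at most $k$ units, and expected payments $p_i(\mathbf v)\ge0$, that is truthful and individually rational: for every $i$ and fixed $\mathbf v_{-i}$, $x_i(v_i,\mathbf v_{-i})$ is non-decreasing in $v_i$, and $p_i(\mathbf v)=v_i x_i(\mathbf v)-\int_0^{v_i}x_i(z,\mathbf v_{-i})\,dz$. Its expected residual surplus on $\mathbf v$ is $M(\mathbf v)=\sum_i\left(v_i x_i(\mathbf v)-p_i(\mathbf v)\right)$. Two-level lottery. For $0\le q\le p\le\infty$, $\mathrm{Lot}_{p,q}$ is the mechanism that first serves agents with values strictly more than $p$, then serves agents with values strictly more than $q$, while the $k$ units last (choosing uniformly at random among agents of the same level when there are not enough units); agents with value at most $q$ are rejected; the expected payment of each agent $i$ is $p_i(\mathbf v)=v_i x_i(\mathbf v)-\int_0^{v_i}x_i(z,\mathbf v_{-i})\,dz$, where $x_i(\mathbf v)$ denotes the probability that this lottery serves agent $i$ on profile $\mathbf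 v$. $\mathrm{Lot}_{p,q}(\mathbf v)$ is its expected residual surplus on $\mathbf v$. Benchmark. $\mathcal G(\mathbf v)=\sup_{0\le q\le p\le\infty}\mathrm{Lot}_{p,q}(\mathbf v)$; this equals the supremum, over all continuous distributions $F$, of the residual surplus on $\mathbf v$ of the symmetric residual-surplus-optimal mechanism for agents with values i.i.d. from $F$. *)

(* Defs.v *)
From HB Require Import structures.
From mathcomp Require Import all_boot all_order all_algebra.
From mathcomp Require Import all_classical all_reals all_analysis.

Set Implicit Arguments.
Unset Strict Implicit.
Unset Printing Implicit Defensive.

Import Order.TTheory GRing.Theory Num.Theory.

Local Open Scope classical_set_scope.
Local Open Scope ring_scope.

Section Mechanisms.
Context {R : realType} {n : nat}.

Definition profile := 'I_n -> R.

(* Valuations live in [0, +oo)^n; conditions are only imposed there. *)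
Definition valuation (v : profile) : Prop := forall i, 0 <= v i.

(* The profile (z, v_{-i}). *)
Definition deviate (v : profile) (i : 'I_n) (z : R) : profile :=
  @dfwith 'I_n (fun=> R) v i z.

(* The units are identical and demand is unit, so a random assignment is the
   law of the random set of served agents: [law M v S] is the probability
   that exactly the agents of [S] are served on profile [v]. *)
Record mechanism := Mechanism {
  law : profile -> {set 'I_n} -> R ;
  payment : profile -> 'I_n -> R }.

Definition serve_prob (d : profile -> {set 'I_n} -> R) (v : profile)
    (i : 'I_n) : R :=
  \sum_(S : {set 'I_n} | i \in S) d v S.

Definition alloc (M : mechanism) : profile -> 'I_n -> R := serve_prob (law M).

Definition envelope_payment (x : profile -> 'I_n -> R) (v : profile)
    (i : 'I_n) : R :=
  v i * x v i -
  Rintegral lebesgue_measure `[0, v i] (fun z : R => x (deviate v i z) i).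

Definition residual_surplus (M : mechanism) (v : profile) : R :=
  \sum_i (v i * alloc M v i - payment M v i).

Definition random_assignment (k : nat) (d : {set 'I_n} -> R) : Prop :=
  [/\ forall S, 0 <= d S,
      \sum_S d S = 1
    & forall S : {set 'I_n}, (k < #|S|)%N -> d S = 0].

Definition platform_mechanism (k : nat) (M : mechanism) : Prop :=
  [/\ forall v, valuation v -> random_assignment k (law M v),
      forall v i, valuation v -> 0 <= payment M v i,
      forall v i (a b : R), valuation v -> 0 <= a -> a <= b ->
        alloc M (deviate v i a) i <= alloc M (deviate v i b) i
    & forall v i, valuation v ->
        payment M v i = envelope_payment (alloc M) v i].

Definition upper_level (p : \bar R) (v : profile) : {set 'I_n} :=
  [set i | (p < (v i)%:E)%E]%SET.

Definition lower_level (p q : \bar R) (v : profile) : {set 'I_n} :=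
  [set i | (q < (v i)%:E <= p)%E]%SET.

(* The possible sets of agents served by the two-level lottery: as many
   upper-level agents as the k units allow, then as many lower-level agents as
   the remaining units (truncated subtraction) allow.  Independent uniform
   choices within the two levels amount to a uniform choice in this family. *)
Definition lot_outcomes (k : nat) (p q : \bar R) (v : profile) :
    {set {set 'I_n}} :=
  [set S : {set 'I_n} |
    [&& S \subset upper_level p v :|: lower_level p q v,
        #|S :&: upper_level p v| == minn k #|upper_level p v|
      & #|S :&: lower_level p q v|
          == minn (k - #|upper_level p v|) #|lower_level p q v|]]%SET.

Definition lot_law (k : nat) (p q : \bar R) (v : profile)
    (S : {set 'I_n}) : R :=
  (S \in lot_outcomes k p q v)%:R / #|lot_outcomes k p q v|%:R.

Definition Lot (k : nat) (p q : \bar R) : mechanism :=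
  Mechanism (lot_law k p q) (envelope_payment (serve_prob (lot_law k p q))).

Definition benchmark (k : nat) (v : profile) : \bar R :=
  ereal_sup [set s : \bar R | exists p q : \bar R,
    (0 <= q <= p)%E /\ s = (residual_surplus (Lot k p q) v)%:E].

End Mechanisms.

Arguments profile R n : clear implicits.
Arguments mechanism R n : clear implicits.

(* Main.v *)
(* Up to a factor 2 the benchmark is attained by one-price lotteries: the
   surplus of Lot_{p,q} is at most the sum of the surpluses of Lot_{p,p} and
   Lot_{q,q}, where Lot_{r,r} has surplus
     L_r(v) = (sum_i max(0, v_i - r)) * k / max(k, #{i | v_i > r}).
   The mechanism draws a uniformly random sample S of agents and a fair coin.
   It runs Lot_{r,r} on the complement of S, where r either maximizes L_r on S
   or is the largest value in S.  Sort the agents by decreasing value, and call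
   S good if it contains the first agent, not the second, and if in every
   longer prefix neither S nor its complement outnumbers the other by more than
   4 to 1.  A positive martingale shows that a constant fraction of the samples
   is good.  By summation by parts, for good S every sum of a nondecreasing
   function of the value over S, or (up to the gap v_(1) - v_(2)) over the
   complement, is at least 1/5 of the sum over all agents, so the price
   maximizing L_r on S is almost optimal on the complement, up to that gap.
   The other price rule earns the gap whenever the second agent is in S and the
   first is not. *)

Require Import Defs.
From HB Require Import structures.
From mathcomp Require Import all_boot all_order all_algebra perm.
From mathcomp Require Import all_classical all_reals all_analysis.
From mathcomp Require Import zify ring lra.

Set Implicit Arguments.
Unset Strict Implicit.
Unset Printing Implicit Defensive.

Import Order.TTheory GRing.Theory Num.Theory.

Local Open Scope ring_scope.

(** * Families of sets invariant under transpositions *)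

Lemma imset_tperm (T : finType) (D : {set T}) (x y : T) :
  (x \in D) = (y \in D) -> (tperm x y @: D = D)%SET.
Proof.
move=> xyD; apply/setP => z; apply/imsetP/idP => [[t tD ->]|zD].
  by case: tpermP tD => [->|->|//]; rewrite xyD.
exists (tperm x y z); last by rewrite tpermK.
by case: tpermP zD => [->|->|//]; rewrite xyD.
Qed.

(** Double counting of the pairs (j, S) with j in both [S] and [D]: transpositions inside [D]
    preserve [O], so all elements of [D] lie in equally many members of [O]. *)
Lemma card_symmetric_family (T : finType) (O : {set {set T}}) (D : {set T})
    (a : nat) (i : T) :
  (forall x y S, x \in D -> y \in D -> S \in O -> (tperm x y @: S)%SET \in O) ->
  (forall S, S \in O -> #|(S :&: D)%SET| = a) -> i \in D ->
  (#|D| * #|[set S in O | i \in S]%SET| = a * #|O|)%N.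
Proof.
move=> Osym OD iD.
have le_ij x y : x \in D -> y \in D ->
    (#|[set S in O | x \in S]%SET| <= #|[set S in O | y \in S]%SET|)%N.
  move=> xD yD; rewrite -(card_imset _ (imset_inj (@perm_inj _ (tperm x y)))).
  apply/subset_leq_card/fintype.subsetP => Z /imsetP[S] + ->{Z}.
  rewrite !inE => /andP[SO xS].
  by rewrite Osym//= -{1}(tpermL x y) imset_f.
transitivity (\sum_(j in D) #|[set S in O | j \in S]%SET|)%N.
  rewrite -sum_nat_const; apply: eq_bigr => j jD.
  by apply/eqP; rewrite eqn_leq !le_ij.
transitivity (\sum_(S in O) #|(S :&: D)%SET|)%N; last first.
  by rewrite (eq_bigr (fun=> a))// sum_nat_const mulnC.
rewrite (eq_bigr (fun j => \sum_(S in O) (j \in S))%N); last first.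
  move=> j _; rewrite -sum1_card big_mkcond/= [RHS]big_mkcond/=.
  by apply: eq_bigr => S _; rewrite inE; case: (S \in O); case: (j \in S).
rewrite exchange_big/=; apply: eq_bigr => S _.
rewrite -sum1_card big_mkcond/= [RHS]big_mkcond/=.
by apply: eq_bigr => j _; rewrite inE; case: (j \in S); case: (j \in D).
Qed.

Lemma exists_subset_card (T : finType) (A : {set T}) (m : nat) :
  (m <= #|A|)%N -> exists2 B : {set T}, B \subset A & #|B| = m.
Proof.
move=> mA; have : (0 < #|[set B : {set T} | B \subset A & #|B| == m]%SET|)%N.
  by rewrite cards_draws bin_gt0.
by case/card_gt0P => B; rewrite inE => /andP[BA /eqP Bm]; exists B.
Qed.

(** * Service probabilities of the two-level lottery *)

Section Lottery.
Context {R : realType} {n : nat}.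
Implicit Types (k : nat) (p q : \bar R) (v : profile R n) (i : 'I_n).

Lemma disjoint_levels p q v i :
  i \in upper_level p v -> i \in lower_level p q v = false.
Proof. by rewrite !inE => pv; rewrite leNgt pv andbF. Qed.

Lemma lot_outcomes_perm k p q v (s : {perm 'I_n}) (S : {set 'I_n}) :
  (s @: upper_level p v = upper_level p v)%SET ->
  (s @: lower_level p q v = lower_level p q v)%SET ->
  S \in lot_outcomes k p q v -> (s @: S)%SET \in lot_outcomes k p q v.
Proof.
move=> sU sW; rewrite !inE => /and3P[SUW SU SW].
rewrite -{1}sU -{1}sW -imsetU finset.imsetS//= -{1}sU -{1}sW.
by rewrite -!(imsetI (in2W perm_inj)) !card_imset ?SU//; exact: perm_inj.
Qed.

Lemma lot_outcomes_gt0 k p q v : (0 < #|lot_outcomes k p q v|)%N.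
Proof.
have [A AU cA] := exists_subset_card (geq_minr k #|upper_level p v|).
have [B BW cB] := exists_subset_card
  (geq_minr (k - #|upper_level p v|) #|lower_level p q v|).
have dUW : [disjoint upper_level p v & lower_level p q v].
  by apply/pred0P => i /=; apply/negP => /andP[/disjoint_levels ->].
apply/card_gt0P; exists (A :|: B)%SET.
rewrite inE finset.setUSS//= !finset.setIUl.
rewrite (finset.setIidPl AU) (finset.setIidPl BW).
rewrite (_ : B :&: _ = finset.set0)%SET ?finset.setU0; last first.
  apply/disjoint_setI0; rewrite disjoint_sym.
  exact: disjointWr BW dUW.
rewrite (_ : A :&: _ = finset.set0)%SET ?finset.set0U ?cA ?cB ?eqxx//.
exact/disjoint_setI0/(disjointWl AU).
Qed.

Lemma serve_prob_lot k p q v i :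
  serve_prob (lot_law k p q) v i =
  #|[set S in lot_outcomes k p q v | i \in S]%SET|%:R /
  #|lot_outcomes k p q v|%:R.
Proof.
rewrite /serve_prob /lot_law -mulr_suml; congr (_ / _).
rewrite -sum1_card natr_sum big_mkcond/= [RHS]big_mkcond/=.
by apply: eq_bigr => S _; rewrite !inE; do 2?case: ifP => //;
  case: (i \in S); rewrite ?andbT ?andbF // => ->.
Qed.

(** [D] stands for one of the two levels: its agents are exchangeable for the lottery, so the [a]
    units that always go to [D] are spread evenly over it. *)
Lemma serve_prob_level k p q v i (D : {set 'I_n}) (a : nat) :
  (forall x y, x \in D -> y \in D ->
    (x \in upper_level p v) = (y \in upper_level p v) /\
    (x \in lower_level p q v) = (y \in lower_level p q v)) ->
  (forall S, S \in lot_outcomes k p q v -> #|(S :&: D)%SET| = a) ->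
  i \in D -> serve_prob (lot_law k p q) v i = a%:R / #|D|%:R.
Proof.
move=> Dlev Da iD; rewrite serve_prob_lot.
have O0 := lot_outcomes_gt0 k p q v.
have D0 : (0 < #|D|)%N by apply/card_gt0P; exists i.
apply/eqP; rewrite eqr_div ?pnatr_eq0 -?lt0n//; apply/eqP.
rewrite -!natrM; congr (_ %:R); rewrite mulnC.
apply: card_symmetric_family => // x y S xD yD.
by have [xyU xyW] := Dlev _ _ xD yD; apply: lot_outcomes_perm; exact: imset_tperm.
Qed.

Lemma serve_prob_upper k p q v i : (p < (v i)%:E)%E ->
  serve_prob (lot_law k p q) v i =
  (minn k #|upper_level p v|)%:R / #|upper_level p v|%:R.
Proof.
move=> pvi; apply: serve_prob_level; last by rewrite inE.
  by move=> x y xU yU; rewrite xU yU !disjoint_levels.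
by move=> S; rewrite inE => /and3P[_ /eqP].
Qed.

Lemma serve_prob_lower k p q v i : (q < (v i)%:E <= p)%E ->
  serve_prob (lot_law k p q) v i =
  (minn (k - #|upper_level p v|) #|lower_level p q v|)%:R /
  #|lower_level p q v|%:R.
Proof.
move=> pvi; apply: serve_prob_level; last by rewrite inE.
  move=> x y xW yW; rewrite xW yW; split=> //.
  move: xW yW; rewrite !inE => /andP[_ xp] /andP[_ yp].
  by rewrite !ltNge xp yp.
by move=> S; rewrite inE => /and3P[_ _ /eqP].
Qed.

Lemma serve_prob_rejected k p q v i : (q <= p)%E -> ((v i)%:E <= q)%E ->
  serve_prob (lot_law k p q) v i = 0.
Proof.
move=> qp viq; rewrite serve_prob_lot.
rewrite (_ : [set S in _ | _]%SET = finset.set0) ?cards0 ?mul0r//.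
apply/setP => S; rewrite !inE; apply/negP.
move=> /andP[/and3P[/fintype.subsetP SUW _ _] iS].
have := SUW _ iS; rewrite !inE => /orP[|/andP[]].
  by rewrite ltNge (le_trans viq).
by rewrite ltNge viq.
Qed.

Lemma lot_law_random_assignment k p q v :
  random_assignment k (lot_law k p q v).
Proof.
have O0 : #|lot_outcomes k p q v|%:R != 0 :> R.
  by rewrite pnatr_eq0 -lt0n lot_outcomes_gt0.
split=> [S||S kS]; first by rewrite /lot_law divr_ge0.
  rewrite /lot_law -mulr_suml -natr_sum.
  by rewrite -big_mkcond/= sum1_card divff.
rewrite /lot_law; case: (boolP (S \in _)) => [|_]; last by rewrite mul0r.
rewrite inE => /and3P[SUW /eqP SU /eqP SW].
suff : (#|S| <= k)%N by rewrite leqNgt kS.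
rewrite -(finset.setIidPl SUW) finset.setIUr (leq_trans (leq_card_setU _ _))//.
by rewrite SU SW; lia.
Qed.

End Lottery.

(** * Integrals of step functions, and rationing rates *)

Section Thresholds.
Context {R : realType}.

Definition excess (r x : R) : R := Num.max 0 (x - r).

Lemma excess_ge0 r x : 0 <= excess r x.
Proof. by rewrite /excess le_max lexx. Qed.

Lemma excess_le r x y : x <= y -> excess r x <= excess r y.
Proof.
by rewrite /excess => xy; case: (lerP 0 (x - r)); case: (lerP 0 (y - r)); lra.
Qed.

Lemma excess_lip r x y : x <= y -> excess r y - excess r x <= y - x.
Proof.
by rewrite /excess => xy; case: (lerP 0 (x - r)); case: (lerP 0 (y - r)); lra.
Qed.

Lemma excess_eq0 r x : x <= r -> excess r x = 0.
Proof. by rewrite /excess => xr; apply/max_idPl; rewrite subr_le0. Qed.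

Lemma excess_lex r x : 0 <= r -> 0 <= x -> excess r x <= x.
Proof. by rewrite /excess => r0 x0; rewrite ge_max x0; lra. Qed.

Lemma integrable_threshold (r x : R) :
  (@lebesgue_measure R).-integrable `[0, x]%classic
    (EFin \o (fun z : R => (r < z)%R%:R)).
Proof.
have : (@lebesgue_measure R).-integrable `[0, x]%classic
    (EFin \o \1_[set` `]r, x]%R]).
  by apply: integrableS (integrable_indic_itv r x false false).
apply: eq_integrable => // z; rewrite inE/= in_itv/= => /andP[_ zx].
by rewrite indicE mem_setE in_itv/= zx andbT.
Qed.

Lemma Rintegral_threshold (r x : R) : 0 <= r ->
  Rintegral lebesgue_measure `[0, x]%classic (fun z : R => (r < z)%R%:R) =
  excess r x.
Proof.
move=> r0; have -> : Rintegral lebesgue_measure `[0, x]%classic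
    (fun z : R => (r < z)%R%:R) =
    Rintegral lebesgue_measure `[0, x]%classic (\1_[set` `]r, x]%R]%classic : R -> R).
  apply: eq_Rintegral => z; rewrite inE/= in_itv/= => /andP[_ zx].
  by rewrite mem_setE in_itv/= zx andbT.
rewrite /Rintegral integral_indic//=.
rewrite (_ : _ `&` _ = [set` `]r, x]%R])%classic; last first.
  rewrite classical_sets.setIidl// => z /=; rewrite !in_itv/= => /andP[rz ->].
  by rewrite andbT (le_trans r0) ?ltW.
rewrite lebesgue_measure_itv/= /excess lte_fin.
by case: ltP => [rx|xr]/=; [rewrite max_r ?subr_ge0 ?ltW|rewrite max_l ?subr_le0].
Qed.

(** By the envelope formula, an agent's surplus is the integral of her service probability over her
    own report. All these probabilities are combinations of steps, so surpluses become sums of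
    excesses. *)
Lemma Rintegral_thresholds (I : Type) (s : seq I) (c r : I -> R) (x : R) :
  (forall j, 0 <= r j) ->
  Rintegral lebesgue_measure `[0, x]%classic
    (fun z : R => \sum_(j <- s) c j * (r j < z)%R%:R) =
  \sum_(j <- s) c j * excess (r j) x.
Proof.
move=> r0.
have intc j : (@lebesgue_measure R).-integrable `[0, x]%classic
    (EFin \o (fun z : R => c j * (r j < z)%R%:R)).
  have : (@lebesgue_measure R).-integrable `[0, x]%classic
      (fun z => ((c j)%:E * (EFin \o (fun z : R => (r j < z)%R%:R)) z)%E).
    by apply: integrableZl => //; exact: integrable_threshold.
  exact: eq_integrable.
elim: s => [|j s IHs].
  rewrite big_nil (eq_Rintegral _ (g := fun=> 0)) ?Rintegral_cst ?mul0r//.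
  by move=> z _; rewrite big_nil.
rewrite big_cons -IHs.
transitivity (Rintegral lebesgue_measure `[0, x]%classic (fun z : R =>
    c j * (r j < z)%R%:R + \sum_(j <- s) c j * (r j < z)%R%:R)).
  by apply: eq_Rintegral => z _; rewrite big_cons.
rewrite RintegralD ?RintegralZl ?Rintegral_threshold//.
  exact: integrable_threshold.
have : (@lebesgue_measure R).-integrable `[0, x]%classic
    (fun z : R => \sum_(j <- s) (c j * (r j < z)%R%:R)%:E)%E.
  by apply: integrable_sum => // i _; exact: intc.
by apply: eq_integrable => // z _ /=; rewrite sumEFin.
Qed.

(** This is min(1, k/m), the chance of a unit when [m] agents compete for [k]; the maximum in the
    denominator makes it 1 at [m = 0] when [k > 0]. *)
Definition serve_rate (k m : nat) : R := k%:R / (maxn k m)%:R.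

Lemma serve_rate_ge0 k m : 0 <= serve_rate k m.
Proof. by rewrite /serve_rate divr_ge0. Qed.

Lemma serve_rate_le k m m' c : (m <= c * m')%N -> (0 < c)%N -> (0 < k)%N ->
  serve_rate k m' <= c%:R * serve_rate k m.
Proof.
move=> mm' c0 k0; rewrite /serve_rate mulrA.
rewrite ler_pdivrMr ?ltr0n ?leq_max ?k0// mulrAC ler_pdivlMr ?ltr0n ?leq_max ?k0//.
have le_max : (maxn k m <= c * maxn k m')%N.
  rewrite geq_max (leq_trans (leq_maxl k m') (leq_pmull _ c0))/=.
  by rewrite (leq_trans mm')// leq_mul2l leq_maxr orbT.
by rewrite -!natrM ler_nat; nia.
Qed.

Lemma serve_rate_le1 k m : (0 < k)%N -> serve_rate k m <= 1.
Proof. by move=> k0; rewrite /serve_rate ler_pdivrMr ?mul1r ?ler_nat ?ltr0n; lia. Qed.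

Lemma serve_rate1 k : (0 < k)%N -> serve_rate k 1 = 1.
Proof. by move=> k0; rewrite /serve_rate (maxn_idPl k0) divff// pnatr_eq0; lia. Qed.

Lemma minn_divE k m : (0 < k)%N -> (0 < m)%N ->
  (minn k m)%:R / m%:R = serve_rate k m.
Proof.
move=> k0 m0; rewrite /serve_rate; apply/eqP.
rewrite eqr_div ?pnatr_eq0 -?lt0n ?leq_max ?k0// -!natrM eqr_nat.
by apply/eqP; case: (leqP k m); nia.
Qed.

(** With [s] upper agents and [t.+1] lower ones, giving precedence to the upper level can only hurt
    a lower agent compared with merging the two levels. *)
Lemma lower_rate_le k s t : (0 < k)%N ->
  (minn (k - s) t.+1)%:R / t.+1%:R <= serve_rate k (s + t).+1.
Proof.
move=> k0; rewrite /serve_rate ler_pdivrMr// mulrAC.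
rewrite ler_pdivlMr ?ltr0n ?leq_max ?k0// -!natrM ler_nat.
by case: (leqP (s + t).+1 k); case: (leqP t.+1 (k - s)); nia.
Qed.

End Thresholds.

(** * Reduction of the benchmark to one-price lotteries *)

Section SurplusFormulas.
Context {R : realType} {n : nat}.
Implicit Types (k : nat) (p q : \bar R) (r : R) (v : profile R n) (i : 'I_n).

Definition lottery_value k r v : R :=
  (\sum_i excess r (v i)) * serve_rate k #|upper_level r%:E v|.

Lemma deviate_same v i z : deviate v i z i = z.
Proof. exact: dfwithin. Qed.

Lemma deviate_other v i z j : j != i -> deviate v i z j = v j.
Proof. by rewrite eq_sym; exact: dfwithout. Qed.

Lemma deviate_id v i : deviate v i (v i) = v.
Proof.
apply/funext => j; have [->|ji] := eqVneq j i; first exact: deviate_same.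
exact: deviate_other.
Qed.

Lemma upper_level_deviate p v i z :
  (upper_level p (deviate v i z) :\ i = upper_level p v :\ i)%SET.
Proof.
by apply/setP => j; rewrite !inE; case: eqVneq => //= ji; rewrite deviate_other.
Qed.

Lemma lower_level_deviate p q v i z :
  (lower_level p q (deviate v i z) :\ i = lower_level p q v :\ i)%SET.
Proof.
by apply/setP => j; rewrite !inE; case: eqVneq => //= ji; rewrite deviate_other.
Qed.

(** The levels of the other agents do not depend on [z], so this is a step function of [z]; each
    [.+1] counts agent [i] herself. *)
Lemma serve_prob_deviate k p q v i z : (0 < k)%N -> (q <= p)%E ->
  serve_prob (lot_law k p q) (deviate v i z) i =
  if (p < z%:E)%E then serve_rate k #|(upper_level p v :\ i)%SET|.+1
  else if (q < z%:E)%E then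
    (minn (k - #|(upper_level p v :\ i)%SET|)
       #|(lower_level p q v :\ i)%SET|.+1)%:R /
    #|(lower_level p q v :\ i)%SET|.+1%:R
  else 0.
Proof.
move=> k0 qp; case: ltP => [pz|zp].
  have iU : i \in upper_level p (deviate v i z) by rewrite inE deviate_same.
  rewrite serve_prob_upper ?deviate_same// (cardsD1 i) iU upper_level_deviate.
  by rewrite minn_divE.
case: ltP => [qz|zq]; last by rewrite serve_prob_rejected// deviate_same.
have iW : i \in lower_level p q (deviate v i z).
  by rewrite inE deviate_same qz.
have iU : i \in upper_level p (deviate v i z) = false.
  by rewrite inE deviate_same ltNge zp.
rewrite serve_prob_lower ?deviate_same ?qz//.
by rewrite (cardsD1 i (upper_level _ _)) (cardsD1 i (lower_level _ _ _)) iW iU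
  upper_level_deviate lower_level_deviate.
Qed.

Lemma residual_surplus_envelope (d : profile R n -> {set 'I_n} -> R) v :
  residual_surplus (Mechanism d (envelope_payment (serve_prob d))) v =
  \sum_i Rintegral lebesgue_measure `[0, v i]%classic
    (fun z : R => serve_prob d (deviate v i z) i).
Proof.
by apply: eq_bigr => i _; rewrite /alloc /= /envelope_payment opprB addrC subrK.
Qed.

Lemma card_upper_levelD p q v i : (q <= p)%E ->
  #|(upper_level q v :\ i)%SET| =
  (#|(upper_level p v :\ i)%SET| + #|(lower_level p q v :\ i)%SET|)%N.
Proof.
move=> qp; rewrite -(cardsID (upper_level p v) (upper_level q v :\ i)%SET).
congr (_ + _)%N; apply: eq_card => j; rewrite !inE.
  have [->//|/=] := eqVneq j i; have [pj|] := ltP p (v j)%:E; last by rewrite andbF.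
  by rewrite (le_lt_trans qp).
by rewrite -leNgt; case: (j != i); case: (q < _)%E; case: (_ <= p)%E.
Qed.

Lemma lottery_valueE k r v :
  lottery_value k r v =
  \sum_i serve_rate k #|(upper_level r%:E v :\ i)%SET|.+1 * excess r (v i).
Proof.
rewrite /lottery_value mulr_suml; apply: eq_bigr => i _.
have [rv|vr] := ltP r (v i); last by rewrite excess_eq0// mul0r mulr0.
by rewrite (cardsD1 i) inE lte_fin rv mulrC.
Qed.

(** With [a] and [b] the service probabilities at the upper and lower level, the integral is (a - b)
    times the excess over [p] plus b times the excess over [q]. Drop -b from the first term and
    bound b in the second by the rate of the merged levels. *)
Lemma Rintegral_lot_le k p q v i : (0 < k)%N -> (0 <= q <= p)%E -> 0 <= v i ->
  Rintegral lebesgue_measure `[0, v i]%classic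
    (fun z : R => serve_prob (lot_law k p q) (deviate v i z) i) <=
  serve_rate k #|(upper_level p v :\ i)%SET|.+1 *
    excess (fine (mine p (v i)%:E)) (v i) +
  serve_rate k #|(upper_level q v :\ i)%SET|.+1 *
    excess (fine (mine q (v i)%:E)) (v i).
Proof.
move=> k0 /andP[q0 qp] vi0; have p0 := le_trans q0 qp.
(* Capping a possibly infinite threshold at [v i] makes it real without changing its comparison with
   any [z <= v i]. *)
have cap (e : \bar R) : (0 <= e)%E -> exists c : R,
    [/\ fine (mine e (v i)%:E) = c, 0 <= c &
      forall z, z <= v i -> (e < z%:E)%E = (c < z)].
  move=> e0; exists (fine (mine e (v i)%:E)); split=> //.
    by apply: fine_ge0; rewrite le_min e0 lee_fin.
  move=> z zv; case: e e0 => [r _||//]; last first.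
    by move=> _; rewrite min_r ?leey// ltNge leey/= ltNge zv.
  rewrite lte_fin; have [rv|vr] := leP r (v i).
    by rewrite min_l ?lee_fin.
  rewrite min_r ?lee_fin ?ltW//=; apply/idP/idP; last by rewrite ltNge zv.
  by move=> rz; have := lt_trans vr (lt_le_trans rz zv); rewrite ltxx.
have [cp [-> cp0 cpE]] := cap _ p0; have [cq [-> cq0 cqE]] := cap _ q0.
rewrite (card_upper_levelD v i qp).
set a := serve_rate k #|(upper_level p v :\ i)%SET|.+1.
set t := #|(lower_level p q v :\ i)%SET|.
set b : R := (minn (k - #|(upper_level p v :\ i)%SET|) t.+1)%:R / t.+1%:R.
have b0 : 0 <= b by rewrite divr_ge0.
have ble := @lower_rate_le R _ #|(upper_level p v :\ i)%SET| t k0.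
(* The sum over [bool] encodes a two-step function: [true] is the step at [p], [false] the step at
   [q]. *)
apply: (@le_trans _ _ (\sum_(j : bool)
    (if j then a - b else b) * excess (if j then cp else cq) (v i))); last first.
  rewrite big_bool/=; apply: lerD; last by rewrite ler_wpM2r ?excess_ge0.
  by rewrite ler_wpM2r ?excess_ge0// gerBl.
rewrite -Rintegral_thresholds; last by case.
rewrite le_eqVlt; apply/orP; left; apply/eqP.
apply: eq_Rintegral => z; rewrite inE/= in_itv/= => /andP[_ zv].
rewrite serve_prob_deviate// big_bool/= -/a -/b cpE// cqE//.
have : cp < z -> cq < z.
  by rewrite -cpE// -cqE//; exact: le_lt_trans.
by case: (cp < z) => [/(_ isT) ->|_]; last case: (cq < z); rewrite /=; lra.
Qed.

Lemma residual_surplus_lot_le k p q v (B : R) : (0 < k)%N -> (0 <= q <= p)%E ->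
  valuation v -> (forall r, 0 <= r -> lottery_value k r v <= B) ->
  residual_surplus (Lot k p q) v <= 2 * B.
Proof.
move=> k0 qp v0 vB; rewrite /Lot residual_surplus_envelope.
have level e : (0 <= e)%E ->
    \sum_i serve_rate k #|(upper_level e v :\ i)%SET|.+1 *
      excess (fine (mine e (v i)%:E)) (v i) <= B.
  case: e => [r|_|//].
    rewrite lee_fin => r0; apply: le_trans (vB _ r0); rewrite lottery_valueE.
    apply: ler_sum => i _; rewrite ler_wpM2l ?serve_rate_ge0//.
    have [rv|vr] := leP r (v i); first by rewrite min_l ?lee_fin.
    by rewrite min_r ?lee_fin ?(ltW vr)//= (excess_eq0 (lexx (v i))) excess_ge0.
  (* An infinite threshold is capped at each agent's own value and contributes 0; price 0 only
     serves to show that [B] is nonnegative. *)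
  apply: le_trans (vB 0 (lexx _)); rewrite big1 => [|i _].
    by rewrite mulr_ge0 ?serve_rate_ge0// sumr_ge0// => i _; exact: excess_ge0.
  by rewrite min_r ?leey//= (excess_eq0 (lexx (v i))) mulr0.
apply: (@le_trans _ _ (\sum_i
    (serve_rate k #|(upper_level p v :\ i)%SET|.+1 *
      excess (fine (mine p (v i)%:E)) (v i) +
    serve_rate k #|(upper_level q v :\ i)%SET|.+1 *
      excess (fine (mine q (v i)%:E)) (v i)))).
  by apply: ler_sum => i _; exact: Rintegral_lot_le.
rewrite big_split/= mulrDl mul1r; case/andP: qp => q0 qp.
by apply: lerD; apply: level => //; exact: le_trans qp.
Qed.

Lemma benchmark_le k v (B : R) : (0 < k)%N -> valuation v ->
  (forall r, 0 <= r -> lottery_value k r v <= B) ->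
  (benchmark k v <= (2 * B)%:E)%E.
Proof.
move=> k0 v0 vB; apply: ge_ereal_sup => _ [p [q [qp ->]]].
by rewrite lee_fin residual_surplus_lot_le.
Qed.

Lemma lottery_value_ge0 k r v : 0 <= lottery_value k r v.
Proof.
by rewrite mulr_ge0 ?serve_rate_ge0// sumr_ge0// => i _; exact: excess_ge0.
Qed.

End SurplusFormulas.

(** * The sampling mechanism: truthfulness and surplus *)

Section SampledThreshold.
Context {R : realType} {n : nat}.
Implicit Types (k : nat) (v : profile R n) (i : 'I_n) (A : {set 'I_n}).

(** Removing agents by zeroing their values keeps the set of agents fixed: prices are nonnegative
    and levels are strict, so an agent of value 0 is never served. *)
Definition restrict A v : profile R n := fun i => if i \in A then v i else 0.

Lemma restrict_deviate_in A v i z : i \in A ->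
  restrict A (deviate v i z) = deviate (restrict A v) i z.
Proof.
move=> iA; apply/funext => j; rewrite /restrict.
have [->|ji] := eqVneq j i; first by rewrite iA !deviate_same.
by rewrite !deviate_other.
Qed.

Lemma restrict_deviate_notin A v i z : i \notin A ->
  restrict A (deviate v i z) = restrict A v.
Proof.
move=> iA; apply/funext => j; rewrite /restrict.
by case: ifP => // jA; rewrite deviate_other//; apply: contraNneq iA => <-.
Qed.

(* A uniform pair [w] of a sample [w.1] and a rule [w.2] prices the complement
   of the sample; the price of an agent never depends on her own report. *)
Definition sample_price (rho : bool -> profile R n -> R) v
    (w : {set 'I_n} * bool) : R :=
  rho w.2 (restrict w.1 v).

Definition sampling_law k (rho : bool -> profile R n -> R) v
    (S : {set 'I_n}) : R :=
  (\sum_w lot_law k (sample_price rho v w)%:E (sample_price rho v w)%:E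
    (restrict (~: w.1)%SET v) S) / #|{: {set 'I_n} * bool}|%:R.

Definition sampling_mechanism k rho : mechanism R n :=
  Mechanism (sampling_law k rho)
    (envelope_payment (serve_prob (sampling_law k rho))).

Variables (k : nat) (rho : bool -> profile R n -> R).
Hypotheses (k0 : (0 < k)%N) (rho0 : forall b w, 0 <= rho b w).

(** The height of the step that the pair [w] contributes to the service probability of [i]. It does
    not depend on [v i]: if [i] is outside the sample, neither the price nor the set of her
    competitors does. *)
Definition sample_rate v i (w : {set 'I_n} * bool) : R :=
  (i \notin w.1)%:R * serve_rate k
    #|(upper_level (sample_price rho v w)%:E (restrict (~: w.1)%SET v) :\ i)%SET|.+1
  / #|{: {set 'I_n} * bool}|%:R.

Lemma sample_rate_ge0 v i w : 0 <= sample_rate v i w.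
Proof. by rewrite /sample_rate divr_ge0// mulr_ge0 ?serve_rate_ge0. Qed.

Lemma serve_prob_sampling v i z :
  serve_prob (sampling_law k rho) (deviate v i z) i =
  \sum_w sample_rate v i w * (sample_price rho v w < z)%R%:R.
Proof.
rewrite /serve_prob /sampling_law -mulr_suml exchange_big/= mulr_suml.
apply: eq_bigr => w _; rewrite -/(serve_prob _ _ i) /sample_rate.
rewrite [RHS]mulrAC; congr (_ / _).
rewrite -[LHS]/(serve_prob (lot_law k _ _) _ i).
have [iw|iw] := boolP (i \in w.1).
  rewrite mul0r mul0r serve_prob_rejected//.
  by rewrite /restrict inE iw lee_fin /sample_price rho0.
have -> : sample_price rho (deviate v i z) w = sample_price rho v w.
  by rewrite /sample_price restrict_deviate_notin.
rewrite restrict_deviate_in ?inE// serve_prob_deviate//.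
by rewrite lte_fin; case: ltP => _; rewrite ?mul1r ?mulr1 ?mulr0.
Qed.

Lemma Rintegral_sampling v i :
  Rintegral lebesgue_measure `[0, v i]%classic
    (fun z : R => serve_prob (sampling_law k rho) (deviate v i z) i) =
  \sum_w sample_rate v i w * excess (sample_price rho v w) (v i).
Proof.
rewrite -Rintegral_thresholds; last by move=> w; exact: rho0.
by apply: eq_Rintegral => z _; rewrite serve_prob_sampling.
Qed.

(** Everything follows from the service probability being a nonnegative combination of steps in the
    agent's own report. A step at price p gives a payment proportional to p if the value exceeds p,
    and 0 otherwise. *)
Lemma sampling_platform : platform_mechanism k (sampling_mechanism k rho).
Proof.
have N0 : #|{: {set 'I_n} * bool}|%:R != 0 :> R.
  by rewrite pnatr_eq0 -lt0n; apply/card_gt0P; exists (finset.set0, true).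
split=> //.
- move=> v _; pose r w := (sample_price rho v w)%:E.
  have lotA w := lot_law_random_assignment k (r w) (r w) (restrict (~: w.1)%SET v).
  split=> [S||S kS]; rewrite /= /sampling_law.
  + rewrite divr_ge0// sumr_ge0// => w _.
    by case: (lotA w) => + _ _; apply.
  + rewrite -mulr_suml exchange_big/= (eq_bigr (fun=> 1)) => [|w _].
      by rewrite sumr_const divff.
    by case: (lotA w).
  + rewrite big1 ?mul0r// => w _.
    by case: (lotA w) => _ _; apply.
- move=> v i v0 /=; rewrite /envelope_payment Rintegral_sampling.
  rewrite -{2}(deviate_id v i) serve_prob_sampling mulr_sumr -sumrB.
  rewrite sumr_ge0// => w _.
  rewrite mulrCA -mulrBr mulr_ge0 ?sample_rate_ge0// subr_ge0.
  have p0 : 0 <= sample_price rho v w by exact: rho0.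
  case: ltP => [_|vp]; first by rewrite mulr1 excess_lex.
  by rewrite excess_eq0// mulr0.
- move=> v i a b v0 a0 ab; rewrite /alloc /= !serve_prob_sampling.
  apply: ler_sum => w _; rewrite ler_wpM2l ?sample_rate_ge0// ler_nat.
  by case: (ltP _ a) => // pa; rewrite (lt_le_trans pa).
Qed.

Lemma sampling_surplus v :
  residual_surplus (sampling_mechanism k rho) v =
  (\sum_w lottery_value k (sample_price rho v w) (restrict (~: w.1)%SET v)) /
  #|{: {set 'I_n} * bool}|%:R.
Proof.
rewrite residual_surplus_envelope (eq_bigr _ (fun i _ => Rintegral_sampling v i)).
rewrite exchange_big mulr_suml/=; apply: eq_bigr => w _.
rewrite lottery_valueE mulr_suml; apply: eq_bigr => i _.
have -> : excess (sample_price rho v w) (restrict (~: w.1)%SET v i) =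
    (i \notin w.1)%:R * excess (sample_price rho v w) (v i).
  rewrite /restrict inE; case: (i \in w.1) => /=; last by rewrite mul1r.
  by rewrite excess_eq0 ?mul0r//; exact: rho0.
by rewrite /sample_rate; ring.
Qed.

End SampledThreshold.

(** * The two pricing rules *)

Section Prices.
Context {R : realType} {n : nat}.
Implicit Types (k : nat) (r : R) (w : profile R n).

(** Lowering a price to the nearest value below it, or to 0, leaves the upper level unchanged and
    increases the excesses, so finitely many candidates suffice. *)
Lemma exists_best_price k w : exists r, 0 <= r /\
  forall r', 0 <= r' -> lottery_value k r' w <= lottery_value k r w.
Proof.
(* Candidate prices: [None] is price 0, [Some i] the positive part of the value of [i]. *)
pose c (o : option 'I_n) := if o is Some i then Num.max 0 (w i) else 0.
have c0 o : 0 <= c o by case: o => [i|] /=; rewrite ?le_max lexx.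
pose best := [arg max_(o > None) lottery_value k (c o) w]%O.
exists (c best); split=> // r' r'0.
have [j cjr' jmax] : exists2 j, c j <= r' &
    forall j', c j' <= r' -> c j' <= c j.
  have := @Order.TotalTheory.arg_maxP _ _ _ None (fun o => c o <= r') c r'0.
  by case=> o; exists o.
apply: (@le_trans _ _ (lottery_value k (c j) w)); last first.
  by rewrite /best; case: Order.TotalTheory.arg_maxP => // o' _; apply.
rewrite /lottery_value (_ : upper_level r'%:E w = upper_level (c j)%:E w).
  rewrite ler_wpM2r ?serve_rate_ge0//; apply: ler_sum => i _.
  by rewrite /excess; case: (lerP 0 (w i - r')); case: (lerP 0 (w i - c j)); lra.
apply/setP => i; rewrite !inE !lte_fin; apply/idP/idP; first exact: le_lt_trans.
move=> cw; rewrite ltNge; apply/negP => wr'.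
have := jmax (Some i); rewrite /= ge_max r'0 wr' => /(_ isT).
by rewrite ge_max (leNgt (w i)) cw andbF.
Qed.

Definition price_rule k (b : bool) w : R :=
  if b then sval (cid (exists_best_price k w)) else \big[Num.max/0]_i w i.

Lemma price_rule_ge0 k b w : 0 <= price_rule k b w.
Proof.
case: b => /=; first by case: cid => r [].
exact: bigmax_ge_id.
Qed.

Lemma best_price k w r : 0 <= r ->
  lottery_value k r w <= lottery_value k (price_rule k true w) w.
Proof. by move=> r0 /=; case: cid => r' /= [_]; apply. Qed.

End Prices.

(** * Balanced random bipartitions of a sequence *)

Section BalancedPartitions.
Context {R : realType} {T : finType}.
Implicit Types (s : seq T) (S : {set T}) (x : T) (a b : nat).

(** The hypothesis says that [g] ignores [x]; adding and removing [x] then pairs the sets, so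
    membership of [x] is a fair coin independent of [g]. *)
Lemma sum_sets_containing x (g : {set T} -> R) :
  (forall S, g (x |: S)%SET = g (S :\ x)%SET) ->
  \sum_(S : {set T}) (x \in S)%:R * g S = 2^-1 * \sum_S g S /\
  \sum_(S : {set T}) (x \notin S)%:R * g S = 2^-1 * \sum_S g S.
Proof.
move=> gx.
have sumD : \sum_S g S = \sum_(S : {set T}) (x \in S)%:R * g S +
    \sum_(S : {set T}) (x \notin S)%:R * g S.
  rewrite -big_split; apply: eq_bigr => S _ /=.
  by case: (x \in S); rewrite /= mul1r mul0r ?addr0 ?add0r.
suff eqS : \sum_(S : {set T}) (x \in S)%:R * g S =
    \sum_(S : {set T}) (x \notin S)%:R * g S.
  by rewrite sumD eqS; split; lra.
have mulb (P : pred {set T}) : \sum_(S : {set T}) (P S)%:R * g S =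
    \sum_(S | P S) g S.
  rewrite [RHS]big_mkcond; apply: eq_bigr => S _.
  by case: (P S); rewrite ?mul1r ?mul0r.
rewrite !mulb (reindex_onto (fun S => x |: S)%SET (fun S => S :\ x)%SET); last first.
  by move=> S xS; rewrite finset.setD1K.
apply: eq_big => [S|S /andP[_ /eqP xS]].
  rewrite finset.setU11/=; apply/eqP/idP => [<-|xS]; first by rewrite !inE eqxx.
  exact: finset.setU1K.
by rewrite gx -{2}xS; congr g; apply/setP => y; rewrite !inE; case: (y == x).
Qed.

(* [a] and [b] count the elements already placed inside and outside [S]. *)
Fixpoint balanced s S a b : bool :=
  ((a <= 4 * b) && (b <= 4 * a))%N &&
  if s is x :: s' then
    if x \in S then balanced s' S a.+1 b else balanced s' S a b.+1
  else true.

Lemma eq_balanced s S S' a b :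
  {in s, S =i S'} -> balanced s S a b = balanced s S' a b.
Proof.
elim: s a b => //= x s IHs a b SS'; rewrite SS' ?mem_head//.
have SS : {in s, S =i S'} by move=> y ys; rewrite SS' // inE ys orbT.
by rewrite !IHs.
Qed.

(* A positive martingale under fair coin flips which is at least 1 wherever the
   counts become unbalanced. *)
Definition imbalance a b : R :=
  32 / 81 * ((1 / 2) ^+ a * (3 / 2) ^+ b + (1 / 2) ^+ b * (3 / 2) ^+ a).

Lemma imbalance_martingale a b :
  imbalance a.+1 b + imbalance a b.+1 = 2 * imbalance a b.
Proof. by rewrite /imbalance !exprS; field. Qed.

Lemma imbalance_ge0 a b : 0 <= imbalance a b.
Proof.
rewrite /imbalance; apply: mulr_ge0; first by lra.
by apply: addr_ge0; apply: mulr_ge0; apply: exprn_ge0; lra.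
Qed.

Lemma imbalance_sym a b : imbalance a b = imbalance b a.
Proof. by rewrite /imbalance addrC. Qed.

(** Already at [a = 4 * b] the second product equals (81/32)^b, at least 81/32, which the factor
    32/81 normalizes to 1. *)
Lemma imbalance_ge1 a b : (0 < b)%N -> (4 * b < a)%N -> 1 <= imbalance a b.
Proof.
move=> b0 ba; rewrite /imbalance.
have pos m : 0 <= (1 / 2 : R) ^+ m by rewrite exprn_ge0//; lra.
have pos' m : 0 <= (3 / 2 : R) ^+ m by rewrite exprn_ge0//; lra.
have : (1 / 2 : R) ^+ b * (3 / 2) ^+ (4 * b) <= (1 / 2) ^+ b * (3 / 2) ^+ a.
  by rewrite ler_wpM2l// ler_weXn2l//; [lra|lia].
have -> : (1 / 2 : R) ^+ b * (3 / 2) ^+ (4 * b) = (81 / 32) ^+ b.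
  by rewrite exprM -exprMn; congr (_ ^+ _); field.
have : (81 / 32 : R) <= (81 / 32) ^+ b by rewrite ler_eXnr//; lra.
have := mulr_ge0 (pos a) (pos' b); lra.
Qed.

(** Optional stopping, by induction on [s]: at unbalanced counts the left side is at most 0;
    otherwise the two outcomes for the next element average out by the martingale identity. *)
Lemma balanced_fraction s a b : uniq s -> (0 < a)%N -> (0 < b)%N ->
  (1 - imbalance a b) * #|{set T}|%:R <= \sum_(S : {set T}) (balanced s S a b)%:R.
Proof.
have [N0 sum0] : 0 <= #|{set T}|%:R :> R /\
    forall s a b, 0 <= \sum_(S : {set T}) (balanced s S a b)%:R :> R.
  by split=> // s' a' b'; apply: sumr_ge0.
have unbalanced a' b' s' : 1 <= imbalance a' b' ->
    (1 - imbalance a' b') * #|{set T}|%:R <=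
      \sum_(S : {set T}) (balanced s' S a' b')%:R.
  by move=> i1; apply: le_trans (sum0 _ _ _); rewrite mulr_le0_ge0// subr_le0.
elim: s a b => [|x s IHs] a b.
  move=> _ a0 b0; have [ab|ab] := boolP ((a <= 4 * b) && (b <= 4 * a))%N.
    rewrite /= ab sumr_const -[leRHS]mul1r ler_wpM2r//.
    by rewrite gerBl imbalance_ge0.
  apply: unbalanced; move: ab; rewrite negb_and -!ltnNge => /orP[ab|ab].
    exact: imbalance_ge1.
  by rewrite imbalance_sym imbalance_ge1.
move=> /andP[xs us] a0 b0; case: (boolP ((a <= 4 * b) && (b <= 4 * a))%N) => ab; last first.
  apply: unbalanced; move: ab; rewrite negb_and -!ltnNge => /orP[ab|ab].
    exact: imbalance_ge1.
  by rewrite imbalance_sym imbalance_ge1.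
rewrite (eq_bigr (fun S => (x \in S)%:R * (balanced s S a.+1 b)%:R +
    (x \notin S)%:R * (balanced s S a b.+1)%:R)); last first.
  move=> S _ /=; rewrite ab.
  by case: (x \in S) => /=; rewrite mul1r mul0r ?addr0 ?add0r.
have inv a' b' S : (balanced s (x |: S)%SET a' b')%:R =
    (balanced s (S :\ x)%SET a' b')%:R :> R.
  congr (nat_of_bool _)%:R; apply: eq_balanced => y ys; rewrite !inE.
  by case: eqVneq => // yx; rewrite -yx ys in xs.
rewrite big_split/= (sum_sets_containing (inv _ _)).1 (sum_sets_containing (inv _ _)).2.
have := IHs _ _ us (ltn0Sn a) b0; have := IHs _ _ us a0 (ltn0Sn b).
have := imbalance_martingale a b; nra.
Qed.

(** Summation by parts as an induction: the [a + b] elements already placed are all charged at the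
    value of the last one, [x], which is a lower bound for them. *)
Lemma balanced_weight s S a b (g : T -> R) x :
  path (fun y z => g z <= g y) x s -> 0 <= g x -> all (fun y => 0 <= g y) s ->
  balanced s S a b ->
  (a + b)%:R * g x + \sum_(y <- s) g y <=
    5 * (a%:R * g x + \sum_(y <- s) (y \in S)%:R * g y) /\
  (a + b)%:R * g x + \sum_(y <- s) g y <=
    5 * (b%:R * g x + \sum_(y <- s) (y \notin S)%:R * g y).
Proof.
elim: s a b x => [|y s IHs] a b x /=.
  move=> _ g0 _; rewrite andbT !big_nil natrD => /andP[].
  rewrite -(ler_nat R) -[(b <= _)%N](ler_nat R) !natrM => ab ba.
  by split; nra.
move=> /andP[yx ys] gx /andP[gy gs] /andP[/andP[]].
rewrite -(ler_nat R) -[(b <= _)%N](ler_nat R) !natrM => ab ba.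
(* Passing from [x] to [y] lowers the charge of the placed elements by g x - g y each; the
   inequality survives since 5a - (a + b) = 4a - b and 5b - (a + b) = 4b - a are nonnegative. *)
have Da := mulr_ge0 (_ : 0 <= g x - g y) (_ : 0 <= 4 * a%:R - b%:R).
have Db := mulr_ge0 (_ : 0 <= g x - g y) (_ : 0 <= 4 * b%:R - a%:R).
have {}Da : 0 <= (g x - g y) * (4 * a%:R - b%:R) by apply: Da; lra.
have {}Db : 0 <= (g x - g y) * (4 * b%:R - a%:R) by apply: Db; lra.
rewrite !big_cons natrD; case: (y \in S) => /(IHs _ _ _ ys gy gs) [];
  rewrite ?addSn ?addnS -[(_.+1)%:R]natr1 natrD /= -?[b.+1%:R]natr1
    -?[a.+1%:R]natr1; split; nra.
Qed.

End BalancedPartitions.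

(** * Lotteries on a subset of the agents *)

Section RestrictedLotteries.
Context {R : realType} {n : nat}.
Implicit Types (k : nat) (r : R) (v : profile R n) (A : {set 'I_n}).

Lemma sum_excess_restrict r v A : 0 <= r ->
  \sum_i excess r (restrict A v i) = \sum_i (i \in A)%:R * excess r (v i).
Proof.
move=> r0; apply: eq_bigr => i _; rewrite /restrict.
by case: (i \in A); rewrite ?mul1r// mul0r excess_eq0.
Qed.

Lemma upper_level_restrict r v A : 0 <= r ->
  upper_level r%:E (restrict A v) = (A :&: upper_level r%:E v)%SET.
Proof.
move=> r0; apply/setP => i; rewrite !inE /restrict !lte_fin.
by case: (i \in A) => //=; rewrite ltNge r0.
Qed.

Lemma card_upper_level r v A : #|(A :&: upper_level r%:E v)%SET|%:R =
  \sum_i (i \in A)%:R * (r < v i)%R%:R :> R.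
Proof.
rewrite -sum1_card natr_sum big_mkcond/=; apply: eq_bigr => i _.
rewrite !inE lte_fin; case: (i \in A); case: (r < v i);
  by rewrite /= ?mulr1 ?mulr0 ?mul0r.
Qed.

Lemma card_upper_level_restrict r v A : 0 <= r ->
  (#|upper_level r%:E (restrict A v)| <= #|upper_level r%:E v|)%N.
Proof.
move=> r0; rewrite upper_level_restrict//.
by rewrite subset_leq_card// finset.subsetIr.
Qed.

Lemma serve_rate_anti k m m' : (0 < k)%N -> (m <= m')%N ->
  serve_rate k m' <= serve_rate k m :> R.
Proof.
move=> k0 mm'; rewrite -[leRHS]mul1r -[1]/(1%:R); apply: serve_rate_le => //.
by rewrite mul1n.
Qed.

Lemma serve_rate_eq1 k m : (0 < k)%N -> (m <= 1)%N -> serve_rate k m = 1 :> R.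
Proof.
move=> k0 m1; apply/eqP; rewrite eq_le serve_rate_le1//= -{1}(@serve_rate1 R k k0).
exact: serve_rate_anti.
Qed.

End RestrictedLotteries.

(** * Analysis with at least two agents, sorted by decreasing value *)

Section SortedAgents.
Context {R : realType} {n : nat}.
Variables (k : nat) (v : profile R n) (h1 h2 : 'I_n) (s : seq 'I_n).
Hypotheses (k0 : (0 < k)%N) (v0 : valuation v).
Hypothesis agents : perm_eq [:: h1, h2 & s] (index_enum 'I_n).
Hypothesis sorted_values : path (fun i j => v j <= v i) h1 (h2 :: s).

Let sumE (F : 'I_n -> R) : \sum_i F i = F h1 + (F h2 + \sum_(i <- s) F i).
Proof. by rewrite -(perm_big _ agents)/= !big_cons. Qed.

Let v21 : v h2 <= v h1.
Proof. by case/andP: sorted_values. Qed.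

Let h12 : h1 != h2.
Proof.
have : uniq [:: h1, h2 & s] by rewrite (perm_uniq agents) index_enum_uniq.
by rewrite /= inE negb_or => /andP[/andP[]].
Qed.

Let le_v2 i : i != h1 -> v i <= v h2.
Proof.
move=> i1; have : i \in [:: h1, h2 & s] by rewrite (perm_mem agents) mem_index_enum.
rewrite !inE (negPf i1)/= => /orP[/eqP->//|ins].
have tr : transitive (fun i j : 'I_n => v j <= v i).
  by move=> a b c ba cb; exact: le_trans cb ba.
by case/andP: sorted_values => _ /(order_path_min tr)/allP/(_ _ ins).
Qed.

(** The initial counts [1 1] record [h1] inside and [h2] outside the sample. *)
Definition good_sample (S : {set 'I_n}) : bool :=
  [&& h1 \in S, h2 \notin S & balanced s S 1 1].

(** [balanced_weight] charges both [h1] and [h2] at the value of [h2]. Restoring the true value of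
    [h1] is harmless on the side of [S], which contains it, and costs the gap on the other side. *)
Lemma good_sample_sums (S : {set 'I_n}) (f : R -> R) : good_sample S ->
  {homo f : x y / x <= y} -> (forall i, 0 <= f (v i)) ->
  \sum_i f (v i) <= 5 * \sum_i (i \in S)%:R * f (v i) /\
  \sum_i f (v i) <=
    5 * \sum_i (i \in (~: S)%SET)%:R * f (v i) + (f (v h1) - f (v h2)).
Proof.
move=> /and3P[S1 S2 bal] fmono f0; rewrite !sumE.
have := @balanced_weight R _ s S 1 1 (f \o v) h2; case=> //=.
- by case/andP: sorted_values => _; apply: sub_path => i j /=; exact: fmono.
- by apply/allP => i _ /=.
rewrite !inE S1 (negPf S2)/= => bS bM; have := fmono _ _ v21.
have -> : \sum_(i <- s) (i \in (~: S)%SET)%:R * f (v i) =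
    \sum_(i <- s) (i \notin S)%:R * f (v i) by apply: eq_bigr => i _; rewrite inE.
by move: bS bM; rewrite !mul1r !mul0r; split; lra.
Qed.

(** With p the best price on [S], three comparisons lose a factor 5 each: price r from all agents to
    [S], then p from [S] to all agents, then p from all agents to the complement. The last one adds
    the gap, hence 25 times it in total. *)
Lemma good_sample_value (S : {set 'I_n}) (r : R) : good_sample S -> 0 <= r ->
  lottery_value k r v <=
  125 * lottery_value k (price_rule k true (restrict S v)) (restrict (~: S)%SET v)
    + 25 * (v h1 - v h2).
Proof.
move=> goodS r0; have p0 := price_rule_ge0 k true (restrict S v).
have best := best_price k (restrict S v) r0.
move: (price_rule _ _ _) p0 best => p p0 best.
have exc q := good_sample_sums goodS (@excess_le _ q) (fun i => excess_ge0 q (v i)).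
have sample : lottery_value k r v <= 5 * lottery_value k r (restrict S v).
  rewrite /lottery_value [leRHS]mulrA; apply: ler_pM; rewrite ?serve_rate_ge0//.
  - by apply: sumr_ge0 => i _; exact: excess_ge0.
  - by rewrite sum_excess_restrict//; exact: (exc r).1.
  - by apply: serve_rate_anti => //; exact: card_upper_level_restrict.
have market : lottery_value k p (restrict S v) <= 5 * lottery_value k p v.
  rewrite /lottery_value [leRHS]mulrCA; apply: ler_pM; rewrite ?serve_rate_ge0//.
  - by apply: sumr_ge0 => i _; exact: excess_ge0.
  - rewrite sum_excess_restrict//; apply: ler_sum => i _.
    by case: (i \in S); rewrite ?mul1r// mul0r excess_ge0.
  (* The indicator of values above p is nondecreasing, so at least a fifth of the agents above p are
     in [S] and rationing among all agents is at most 5 times harsher. *)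
  - apply: (@serve_rate_le R k _ _ 5) => //; rewrite -(ler_nat R) natrM.
    rewrite upper_level_restrict// card_upper_level.
    rewrite -[upper_level _ _]finset.setTI card_upper_level.
    rewrite (eq_bigr (fun i => (p < v i)%R%:R)) => [|i _]; last by rewrite inE mul1r.
    apply: (@good_sample_sums S (fun x => (p < x)%R%:R) goodS _ _).1 => //.
    move=> x y xy; rewrite ler_nat.
    by case: (ltP p x) => // px; rewrite (lt_le_trans px).
(* Fewer competitors only raise the rate on the complement; the gap in excesses is at most the gap
   in values, and the rate multiplying it is at most 1. *)
have rest : lottery_value k p v <=
    5 * lottery_value k p (restrict (~: S)%SET v) + (v h1 - v h2).
  rewrite /lottery_value.
  have rate_le := @serve_rate_anti R k _ _ k0
    (card_upper_level_restrict v (~: S)%SET p0).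
  have rate1 := @serve_rate_le1 R k #|upper_level p%:E v| k0.
  have rate0 := @serve_rate_ge0 R k #|upper_level p%:E v|.
  have := (exc p).2; rewrite -sum_excess_restrict//.
  have : 0 <= \sum_i excess p (restrict (~: S)%SET v i).
    by apply: sumr_ge0 => i _; exact: excess_ge0.
  have := excess_lip p v21; have := excess_le p v21.
  move: rate_le rate1 rate0.
  move: (serve_rate _ _) (serve_rate _ _) => a b ab b1 b0.
  move: (\sum_i _) (\sum_i _) (excess p _) (excess p _) => X Y e1 e2 e21 elip Y0 XY.
  have XbY : X * b <= (5 * Y + (e1 - e2)) * b by rewrite ler_wpM2r.
  have Yab : Y * b <= Y * a by rewrite ler_wpM2l.
  have eb : (e1 - e2) * b <= e1 - e2 by rewrite ler_piMr// subr_ge0.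
  by lra.
lra.
Qed.

(** The price is exactly [v h2], and only [h1] can exceed it, so she is not rationed. *)
Lemma second_price_value (S : {set 'I_n}) : h1 \notin S -> h2 \in S ->
  v h1 - v h2 <=
  lottery_value k (price_rule k false (restrict S v)) (restrict (~: S)%SET v).
Proof.
move=> S1 S2; have -> : price_rule k false (restrict S v) = v h2.
  apply/eqP; rewrite eq_le /=; apply/andP; split.
    apply/bigmax_leP; split=> // i _; rewrite /restrict; case: ifP => // iS.
    by apply: le_v2; apply: contraNneq S1 => <-.
  apply: le_trans (le_bigmax _ _ h2); by rewrite /restrict S2.
rewrite /lottery_value serve_rate_eq1//; last first.
  rewrite upper_level_restrict// -(cards1 h1) subset_leq_card//.
  apply/fintype.subsetP => i; rewrite !inE lte_fin => /andP[_].
  by apply: contraLR => /le_v2; rewrite leNgt.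
rewrite mulr1 (bigD1 h1)//= /restrict inE S1/=.
rewrite -[leLHS]addr0; apply: lerD; first by rewrite /excess le_max lexx orbT.
by apply: sumr_ge0 => i _; exact: excess_ge0.
Qed.

Lemma good_sample_fraction :
  10^-1 * #|{set 'I_n}|%:R <= \sum_(S : {set 'I_n}) (good_sample S)%:R :> R.
Proof.
have us : uniq [:: h1, h2 & s] by rewrite (perm_uniq agents) index_enum_uniq.
case/and3P: us; rewrite inE negb_or => /andP[_ s1] s2 us.
have ext i : i \notin s -> forall S : {set 'I_n},
    balanced s (i |: S)%SET 1 1 = balanced s (S :\ i)%SET 1 1.
  move=> nis S; apply: eq_balanced => j js; rewrite !inE.
  by case: eqVneq => // ji; rewrite -ji js in nis.
rewrite (eq_bigr (fun S : {set 'I_n} => (h1 \in S)%:R *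
    ((h2 \notin S)%:R * (balanced s S 1 1)%:R))); last first.
  by move=> S _; rewrite -!natrM !mulnb.
rewrite (sum_sets_containing _).1; last first.
  by move=> S; rewrite ext// !inE eq_sym (negPf h12).
rewrite (sum_sets_containing _).2; last by move=> S; rewrite ext.
(* [imbalance 1 1] is 16/27, so the fraction of good samples is at least 1/4 of 11/27, that is
   11/108, above 1/10. *)
have := @balanced_fraction R _ s 1 1 us isT isT.
rewrite /imbalance !expr1; have : 0 <= #|{set 'I_n}|%:R :> R by [].
lra.
Qed.

Lemma second_price_fraction :
  \sum_(S : {set 'I_n}) ((h1 \notin S) && (h2 \in S))%:R =
  4^-1 * #|{set 'I_n}|%:R :> R.
Proof.
rewrite (eq_bigr (fun S : {set 'I_n} => (h1 \notin S)%:R *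
    ((h2 \in S)%:R * 1))); last first.
  by move=> S _; rewrite mulr1 -natrM mulnb.
rewrite (sum_sets_containing _).2; last first.
  by move=> S; rewrite !inE eq_sym (negPf h12).
rewrite (sum_sets_containing _).1// sumr_const.
by rewrite mulrA; congr (_ * _); field.
Qed.

Lemma sampling_value_sorted (r : R) : 0 <= r ->
  lottery_value k r v <=
  2500 * residual_surplus (sampling_mechanism k (price_rule k)) v.
Proof.
move=> r0; rewrite sampling_surplus//; last exact: price_rule_ge0.
rewrite card_prod card_bool natrM.
set N : R := #|{set 'I_n}|%:R.
have N0 : 0 < N by rewrite ltr0n; apply/card_gt0P; exists finset.set0.
rewrite mulrA ler_pdivlMr ?mulr_gt0//.
pose val S b := lottery_value k (price_rule k b (restrict S v))
  (restrict (~: S)%SET v).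
have -> : \sum_w lottery_value k (sample_price (price_rule k) v w)
    (restrict (~: w.1)%SET v) = \sum_S val S true + \sum_S val S false.
  rewrite -big_split/= (eq_bigr (fun w => val w.1 w.2)); last by move=> [].
  by rewrite -(pair_bigA _ val)/=; apply: eq_bigr => S _; rewrite big_bool.
set G := lottery_value k r v; set d := v h1 - v h2.
have d0 : 0 <= d by rewrite subr_ge0.
have valF : 4^-1 * N * d <= \sum_S val S false.
  rewrite -second_price_fraction mulr_suml; apply: ler_sum => S _.
  case: andP => [[S1 S2]|_]; last by rewrite mul0r lottery_value_ge0.
  by rewrite mul1r; exact: second_price_value.
have valT0 : 0 <= \sum_S val S true.
  by apply: sumr_ge0 => S _; exact: lottery_value_ge0.
(* If the gap dominates, the second rule alone suffices. Otherwise [G - 25 * d] is positive and can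
   be summed over the good samples; 2500 is 2 for the coin, 10 for the fraction of good samples, 125
   for the loss on each. *)
have [Gd|dG] := leP G (25 * d).
  by have := ler_wpM2r (ltW N0) Gd; have := mulr_ge0 (ltW N0) d0; lra.
have valT : 10^-1 * N * (G - 25 * d) <= 125 * \sum_S val S true.
  apply: (@le_trans _ _ (\sum_S (good_sample S)%:R * (G - 25 * d))).
    by rewrite -mulr_suml ler_wpM2r ?good_sample_fraction// subr_ge0 ltW.
  rewrite mulr_sumr; apply: ler_sum => S _.
  case: (boolP (good_sample S)) => [goodS|_]; last first.
    by rewrite mul0r mulr_ge0// lottery_value_ge0.
  by rewrite mul1r lerBlDr; exact: good_sample_value.
have := mulr_ge0 (ltW N0) d0; move: valT valF; lra.
Qed.

End SortedAgents.

(** * Arbitrary profiles and the competitive ratio *)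

Lemma sampling_value (R : realType) (n k : nat) (v : profile R n) (r : R) :
  (0 < n)%N -> (0 < k)%N -> valuation v -> 0 <= r ->
  lottery_value k r v <=
  2500 * residual_surplus (sampling_mechanism k (price_rule k)) v.
Proof.
move=> n0 k0 v0 r0.
pose ord (i j : 'I_n) := v j <= v i.
have ord_total : total ord by move=> i j; exact: le_total.
have := sort_sorted ord_total (index_enum 'I_n).
have : perm_eq (sort ord (index_enum 'I_n)) (index_enum 'I_n) by rewrite perm_sort.
case: (sort ord _) => [|h1 [|h2 s]] agents ordered.
- have := perm_mem agents (Ordinal n0).
  by rewrite mem_index_enum.
- have n1 : n = 1%N by rewrite -[n]size_enum_ord enumT -(perm_size agents).
  have sumE (F : 'I_n -> R) : \sum_i F i = F h1.
    by rewrite -(perm_big _ agents)/= big_seq1.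
  rewrite sampling_surplus//; last exact: price_rule_ge0.
  set N : R := #|_|%:R.
  have N4 : N = 4.
    rewrite /N card_prod card_bool -cardsT -finset.powersetT card_powerset.
    by rewrite cardsT card_ord n1.
  have ratele1 w q : serve_rate k #|upper_level q w : {set 'I_n}| = 1 :> R.
    by rewrite serve_rate_eq1// (leq_trans (max_card _))// card_ord n1.
  have Xv : v h1 <= \sum_w lottery_value k (sample_price (price_rule k) v w)
      (restrict (~: w.1)%SET v).
    (* A single agent has no runner-up, but one of the four pairs, the empty sample with the second
       rule, offers her a unit at price 0. *)
    rewrite (bigD1 (finset.set0, false))//= -[leLHS]addr0.
    apply: lerD; last by apply: sumr_ge0 => w _; exact: lottery_value_ge0.
    rewrite /lottery_value ratele1 mulr1 sumE /sample_price /=.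
    rewrite /restrict finset.setC0 inE /excess.
    rewrite (_ : \big[_/_]_i _ = 0) ?subr0 ?le_max ?lexx ?orbT//.
    by rewrite big1_idem//= ?maxxx// => i _; rewrite inE.
  rewrite /lottery_value ratele1 mulr1 sumE N4 mulrA ler_pdivlMr//.
  have := excess_lex r0 (v0 h1); have := v0 h1; lra.
- exact: (sampling_value_sorted k0 v0 agents ordered r0).
Qed.

Theorem theorem5p11 (R : realType) :
  exists beta : R, 0 < beta /\
    forall n k : nat, (1 <= n)%N -> (1 <= k)%N ->
      exists M : mechanism R n, platform_mechanism k M /\
        forall v : profile R n, valuation v ->
          (beta^-1%:E * benchmark k v <= (residual_surplus M v)%:E)%E.
Proof.
(* 5000 is 2 for passing from two-level to one-price lotteries, times 2500 for sampling. *)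
have beta0 : 0 < 5000 :> R by lra.
exists 5000; split=> [|n k n0 k0]; first exact: beta0.
exists (sampling_mechanism k (price_rule k)); split.
  exact: sampling_platform k0 (price_rule_ge0 k).
move=> v v0.
have := benchmark_le k0 v0 (fun r r0 => sampling_value n0 k0 v0 r0).
rewrite muleC lee_pdivrMr; last exact: beta0.
move=> bench; apply: le_trans bench _; rewrite -EFinM lee_fin; lra.
Qed.
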